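(* Let $\varphi\colon\mathbb{R}^n\to\overline{\mathbb{R}}$ be a lower semicontinuous function, and fix $\bar x\in\mathbb{R}^n$ such that $|\varphi(\bar x)|<\infty$. Then the following assertions hold. (a) Pick $u\in\mathbb{S}$. If $\mathrm{d}\varphi(\bar x)(u)>0$, then the first-order growth condition holds for $\varphi$ in direction $u$ at $\bar x$. Particularly, $\bar x$ is a strict local minimizer of $\varphi$ in direction $u$. (b) If $\mathrm{d}\varphi(\bar x)(u)>0$ for all $u\in\mathbb{S}$, then the first-order growth condition holds for $\varphi$ at $\bar x$. Particularly, $\bar x$ is a strict local minimizer of $\varphi$.
   Context: $\overline{\mathbb{R}}:=\mathbb{R}\cup\{-\infty,\infty\}$; $\|\cdot\|$ is the Euclidean norm; $\mathbb{S}:=\{u\in\mathbb{R}^n : \|u\|=1\}$. Directional neighborhoods: for $\varepsilon,\rho>0$ and $u\in\mathbb{R}^n$, $\mathbb{B}_{\varepsilon,\rho}(u):=\{w\in\mathbb{R}^n : \|w\|\le\varepsilon,\ \big\|\|w\|u-\|u\|w\big\|\le\rho\|u\|\|w\|\}$; note $\mathbb{B}_{\varepsilon,\rho}(0)$ is the closed ball of radius $\varepsilon$ around $0$. Strict directional local minimality: $\bar x$ is a strict local minimizer of $\varphi$ in direction $u$ if there are $\varepsilon,\rho>0$ with $\varphi(x)>\varphi(\bar x)$ for all $x\in\bar x+\mathbb{B}_{\varepsilon,\rho}(u)$ with $x\ne\bar x$. A strict local minimizer is meant in the usual sense (equivalently, $u=0$). First-order growth condition: it holds for $\varphi$ in direction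 $u\in\mathbb{R}^n$ at $\bar x$ if there are $\varepsilon,\rho,\kappa>0$ with $\varphi(x)\ge\varphi(\bar x)+\kappa\|x-\bar x\|$ for all $x\in\bar x+\mathbb{B}_{\varepsilon,\rho}(u)$. It holds for $\varphi$ at $\bar x$ if this is true for $u:=0$. First subderivative: $\mathrm{d}\varphi(\bar x)(u):=\liminf_{t\downarrow0,\,u'\to u}\frac{\varphi(\bar x+tu')-\varphi(\bar x)}{t}$. *)

(* Defs.v *)
From HB Require Import structures.
From mathcomp Require Import all_boot all_order all_algebra.
From mathcomp Require Import all_classical all_reals all_analysis.
Import Order.TTheory GRing.Theory Num.Theory.
Import numFieldNormedType.Exports.

Set Implicit Arguments.
Unset Strict Implicit.
Unset Printing Implicit Defensive.

Local Open Scope classical_set_scope.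
Local Open Scope ring_scope.

(* [`|w|] on ['rV[R]_n] is the sup norm, so the Euclidean norm is defined here;
   the library topology on ['rV[R]_n] is the usual one for either norm. *)
Definition enorm (R : realType) (n : nat) (w : 'rV[R]_n) : R :=
  Num.sqrt (\sum_(i < n) w 0 i ^+ 2).

Definition usphere (R : realType) (n : nat) : set 'rV[R]_n :=
  [set u | enorm u = 1].

Definition dirball (R : realType) (n : nat) (eps rho : R) (u : 'rV[R]_n) :
    set 'rV[R]_n :=
  [set w | enorm w <= eps /\
           enorm (enorm w *: u - enorm u *: w) <= rho * enorm u * enorm w].

Local Open Scope ereal_scope.

Definition strict_local_min_dir (R : realType) (n : nat)
    (phi : 'rV[R]_n -> \bar R) (xbar u : 'rV[R]_n) : Prop :=
  exists eps rho : R, [/\ (0 < eps)%R, (0 < rho)%R &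
    forall x, dirball eps rho u (x - xbar)%R -> x != xbar ->
      phi xbar < phi x].

Definition strict_local_min (R : realType) (n : nat)
    (phi : 'rV[R]_n -> \bar R) (xbar : 'rV[R]_n) : Prop :=
  \forall x \near xbar, x != xbar -> phi xbar < phi x.

Definition first_order_growth_dir (R : realType) (n : nat)
    (phi : 'rV[R]_n -> \bar R) (xbar u : 'rV[R]_n) : Prop :=
  exists eps rho kappa : R, [/\ (0 < eps)%R, (0 < rho)%R, (0 < kappa)%R &
    forall x, dirball eps rho u (x - xbar)%R ->
      phi xbar + (kappa * enorm (x - xbar))%:E <= phi x].

Definition first_order_growth (R : realType) (n : nat)
    (phi : 'rV[R]_n -> \bar R) (xbar : 'rV[R]_n) : Prop :=
  first_order_growth_dir phi xbar 0%R.

(* The limit inferior is over the product of the filters [t --> 0] with [t > 0]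
   and [u' --> u], where [u' = u] is allowed. *)
Definition subderivative (R : realType) (n : nat)
    (phi : 'rV[R]_n -> \bar R) (xbar u : 'rV[R]_n) : \bar R :=
  limf_einf
    (fun p : R * 'rV[R]_n =>
       (phi (xbar + p.1 *: p.2)%R - phi xbar) * (p.1^-1)%:E)
    (filter_prod 0^'+ (nbhs u)).

(* Main.v *)
Require Import Defs.
From HB Require Import structures.
From mathcomp Require Import all_boot all_order all_algebra.
From mathcomp Require Import all_classical all_reals all_analysis.
Import Order.TTheory GRing.Theory Num.Theory.
Import numFieldNormedType.Exports.

Set Implicit Arguments.
Unset Strict Implicit.
Unset Printing Implicit Defensive.

(** The lower limit defining the subderivative at [u] is a supremum, over product
neighbourhoods of [(0+, u)], of infima of difference quotients. If it is
positive, one such infimum is at least some [k > 0]: every direction [v] close to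
[u] satisfies [phi (xbar + t v) >= phi xbar + k t] for all small [t > 0]. The
predicate [ray_growth e v] expresses this estimate with a single number [e]
serving both as the slope and as the maximal step length, and
[ray_growth_near] says that it holds for all [v] near [u] and all small [e].

It remains to turn growth along rays into growth on a directional
neighbourhood. Writing a nonzero [w = x - xbar] as [t v] with [t = ||w||] and
[v] on the sphere, the condition defining [dirball] divides by [t] and becomes
a condition on [v] alone, namely [||u - ||u|| v|| <= rho ||u||]
([first_order_growth_dir_rays]).

For a unit vector [u] this says that [v] is [rho]-close to [u], so a small
[rho] gives (a). For [u = 0] every unit [v] is allowed, so (b) requires one [e]
valid on the whole sphere; compactness of the sphere ([usphere_compact])
supplies it from the local estimates. Strict minimality follows in both cases
since the growth term is positive away from [xbar]. *)

Local Open Scope classical_set_scope.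
Local Open Scope ereal_scope.

(** * The Euclidean norm and its sphere *)

Section EuclideanNorm.
Context {R : realType} {n : nat}.
Implicit Types (u v w : 'rV[R]_n).
Local Open Scope ring_scope.

Lemma enorm_ge0 w : 0 <= enorm w.
Proof. exact: sqrtr_ge0. Qed.

Lemma enormZ (a : R) w : enorm (a *: w) = `|a| * enorm w.
Proof.
rewrite /enorm; under eq_bigr do rewrite mxE exprMn.
by rewrite -mulr_sumr sqrtrM ?sqr_ge0// sqrtr_sqr.
Qed.

(** The topology of ['rV[R]_n] comes from the sup norm; this comparison transfers
    Euclidean estimates to it. *)
Lemma mx_norm_le_enorm w : `|w| <= enorm w.
Proof.
rewrite [leLHS]/Num.Def.normr/= mx_normrE (bigmax_le _ (enorm_ge0 w))//= => -[i j] _.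
rewrite ord1 -sqrtr_sqr ler_sqrt; last first.
  by apply: sumr_ge0 => k _; exact: sqr_ge0.
rewrite (bigD1 j)//= lerDl; apply: sumr_ge0 => k _; exact: sqr_ge0.
Qed.

Lemma enorm0 : enorm (0 : 'rV[R]_n) = 0.
Proof. by rewrite -(scale0r 0) enormZ normr0 mul0r. Qed.

Lemma enorm_eq0 w : (enorm w == 0) = (w == 0).
Proof.
apply/eqP/eqP => [w0|->]; last exact: enorm0.
by apply/normr0_eq0/le_anti; rewrite normr_ge0 -w0 mx_norm_le_enorm.
Qed.

Lemma enorm_continuous : continuous (@enorm R n).
Proof.
move=> w; apply: continuous_comp; last exact: sqrt_continuous.
apply: continuous_big => [|i _ v]; first exact: add_continuous.
have cvi : {for v, continuous (fun x : 'rV[R]_n => x 0 i)} by exact: coord_continuous.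
under eq_fun do rewrite expr2; exact: (cvgM cvi cvi).
Qed.

(** Euclidean balls are neighbourhoods. It is enough to see this at [0], where it
    is continuity of the norm, as the sup-norm balls are translation invariant. *)
Lemma near_enormB_lt u (e : R) : 0 < e -> \forall v \near u, enorm (v - u) < e.
Proof.
move=> e0.
have : nbhs (0 : 'rV[R]_n) [set w | enorm w < e].
  apply: (@enorm_continuous 0 [set a | a < e]).
  by rewrite enorm0; exact: lt_nbhsl.
move=> /nbhs_ballP[d/= d0 dB]; apply/nbhs_ballP; exists d => // v.
rewrite mx_norm_ball /ball_/= distrC => uv; apply: dB.
by rewrite mx_norm_ball /ball_/= sub0r normrN.
Qed.

Lemma usphere_compact : compact (@usphere R n).
Proof.
apply: bounded_closed_compact.
  exists 1; split => // M M1 u u1.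
  by rewrite /= (le_trans (mx_norm_le_enorm u))// u1 ltW.
have -> : @usphere R n = @enorm R n @^-1` [set 1] by [].
by apply: preimage_closed => [w _|]; [exact: enorm_continuous|exact: closed_eq].
Qed.

End EuclideanNorm.

(** * From rays to directional neighbourhoods *)

Section Growth.
Context {R : realType} {n : nat}.
Context (phi : 'rV[R]_n -> \bar R) (xbar : 'rV[R]_n).
Implicit Types (u v : 'rV[R]_n) (e : R).

(** The number [e] bounds the step from above and the slope from below, so that
    the estimate weakens as [e] decreases: a locally uniform bound is then a
    single statement about [e] tending to [0+]. *)
Definition ray_growth e v : Prop := forall t : R, (0 < t <= e)%R ->
  phi xbar + (e * t)%:E <= phi (xbar + t *: v)%R.

(** A positive lower limit provides a box [B x C] of steps and directions on
    which the difference quotients are at least some [k > 0]; any [e] below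
    both [k] and the radius of [B] then works for every direction in [C]. *)
Lemma ray_growth_near u : phi xbar \is a fin_num ->
  0 < subderivative phi xbar u ->
  \forall v \near u & e \near 0^'+, ray_growth e v.
Proof.
move=> phi_fin; rewrite /subderivative limf_einfE.
move=> /ereal_sup_gt[_ [A [[B C]/= [B0 Cu] BCA] <-] inf_gt0].
have [k k0 k_inf] : exists2 k : R, (0 < k)%R & forall p, A p ->
    k%:E <= (phi (xbar + p.1 *: p.2)%R - phi xbar) * (p.1^-1)%:E.
  set m := ereal_inf _ in inf_gt0.
  (* The infimum itself may be [+oo]; any positive real then serves as [k]. *)
  have [k k0 km] : exists2 k : R, (0 < k)%R & k%:E <= m.
    case: m inf_gt0 => [r|_|//]; first by rewrite lte_fin => r0; exists r.
    by exists 1%R => //; rewrite leey.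
  by exists k => // p Ap; apply: (le_trans km); apply: ereal_inf_lbound; exists p.
have /nbhs_ballP[d/= d0 dB] := B0.
near=> v e.
have ed : (e < d)%R by near: e; exact: nbhs_right_lt.
have ek : (e < k)%R by near: e; exact: nbhs_right_lt.
have Cv : C v by near: v.
move=> t /andP[t0 te].
have Bt : B t.
  by apply: dB => //; rewrite /ball/= sub0r normrN gtr0_norm// (le_lt_trans te).
have /k_inf/= : A (t, v) by apply: BCA.
rewrite lee_pdivlMr// leeBrDl// => kt; apply: le_trans kt.
by rewrite leeD2l// lee_fin ler_wpM2r ?ltW.
Unshelve. all: by end_near. Qed.

(** Under the polar decomposition [w = t v], the two conditions defining
    [dirball] separate: the first bounds the step [t] by [e], and the second, being
    homogeneous in [w], constrains only the direction [v]. The premise is stated so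
    that it serves unit vectors [u] and [u = 0] alike. *)
Lemma first_order_growth_dir_rays u e rho : (0 < e)%R -> (0 < rho)%R ->
  (forall v, usphere v -> (enorm (u - enorm u *: v) <= rho * enorm u)%R ->
    ray_growth e v) ->
  first_order_growth_dir phi xbar u.
Proof.
move=> e0 rho0 grow; exists e, rho, e; split => // x.
rewrite /dirball/=; set w := (x - xbar)%R => -[we wu].
have -> : x = (xbar + w)%R by rewrite addrC subrK.
have [->|w_neq0] := eqVneq w 0%R.
  by rewrite enorm0 mulr0 adde0 addr0.
have w0 : (0 < enorm w)%R by rewrite lt_def enorm_eq0 w_neq0 enorm_ge0.
have wE : (w = enorm w *: ((enorm w)^-1 *: w))%R.
  by rewrite scalerA divff ?gt_eqF// scale1r.
rewrite {2}wE; apply: grow; last by rewrite w0.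
  by rewrite /usphere/= enormZ ger0_norm ?invr_ge0 ?enorm_ge0// mulVf// gt_eqF.
(* Multiplying the direction condition by [enorm w] gives back [wu]. *)
rewrite -(ler_pM2l w0) -[X in (X * enorm (_ - _))%R]gtr0_norm// -enormZ.
by rewrite scalerBr scalerA mulrC -scalerA -wE mulrC.
Qed.

Lemma first_order_growth_dir_strict u : phi xbar \is a fin_num ->
  first_order_growth_dir phi xbar u -> strict_local_min_dir phi xbar u.
Proof.
move=> phi_fin [e [rho [k [e0 rho0 k0 grow]]]]; exists e, rho; split => // x /grow + xx.
apply: lt_le_trans; rewrite lteDl// lte_fin mulr_gt0// lt_def enorm_ge0 andbT.
by rewrite enorm_eq0 subr_eq0.
Qed.

(** The directional neighbourhoods of the zero vector are Euclidean balls. *)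
Lemma strict_local_min_dir0 :
  strict_local_min_dir phi xbar 0%R -> strict_local_min phi xbar.
Proof.
move=> [e [rho [e0 rho0 smin]]].
have := near_enormB_lt xbar e0.
apply: filterS => x xe; apply: smin; split; first exact: ltW.
by rewrite scaler0 enorm0 scale0r subr0 enorm0 mulr0 mul0r.
Qed.

End Growth.

Theorem proposition3p8 (R : realType) (n : nat) (phi : 'rV[R]_n -> \bar R)
    (xbar : 'rV[R]_n)
    (phi_lsc : lower_semicontinuous phi)
    (phi_fin : `|phi xbar| < +oo) :
  (forall u : 'rV[R]_n, usphere u ->
     0 < subderivative phi xbar u ->
     first_order_growth_dir phi xbar u /\ strict_local_min_dir phi xbar u) /\
  ((forall u : 'rV[R]_n, usphere u -> 0 < subderivative phi xbar u) ->
     first_order_growth phi xbar /\ strict_local_min phi xbar).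
Proof.
have phi_num : phi xbar \is a fin_num by rewrite -abse_fin_num ge0_fin_numE.
split => [u u1 /(ray_growth_near phi_num) grow|d_gt0].
  suff growth : first_order_growth_dir phi xbar u.
    by split => //; exact: first_order_growth_dir_strict.
  have [[B C]/= [/nbhs_ballP[r/= r0 rB] C0] BC] := grow.
  have [e [Ce e0]] := filter_ex (filterI C0 (nbhs_right_gt 0%R)).
  (* Halved because [dirball] is closed while the ball inside [B] is open. *)
  have r20 : (0 < r / 2)%R by rewrite divr_gt0.
  apply: (first_order_growth_dir_rays e0 r20) => v v1.
  rewrite u1 scale1r mulr1 => uv.
  apply: (BC (v, e)); split => //; apply: rB.
  rewrite mx_norm_ball /ball_/=.
  rewrite (le_lt_trans (mx_norm_le_enorm _))// (le_lt_trans uv)//.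
  by rewrite ltr_pdivrMr// ltr_pMr// ltr1n.
suff growth : first_order_growth phi xbar.
  by split => //; apply: strict_local_min_dir0; exact: first_order_growth_dir_strict.
have grow : \forall e \near 0^'+, @usphere R n `<=` ray_growth phi xbar e.
  apply: (iffLR (compact_near_coveringP _) usphere_compact) => u u1.
  exact/ray_growth_near/d_gt0.
have [e [grow_e e0]] :=
  @filter_ex _ _ (at_right_proper_filter 0%R) _ (filterI grow (nbhs_right_gt 0%R)).
apply: (first_order_growth_dir_rays e0 ltr01) => v v1 _.
exact: grow_e.
Qed.
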